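(* Let $m,k\in\mathbb{N}$ and let $H=\langle x_1,x_2,\dots,x_m\rangle$ be a commutative subgroup of $S_n$ of order $2^k$. Suppose there exists $x\in S_n\setminus H$ with $x^2=x_1$. If $xx_i=x_ix$ for all $i\in\{2,3,\dots,m\}$, then $H$ is not a perfect code of $S_n$.
   Context: For a group $G$ and a subset $S\subseteq G\setminus\{1_G\}$ with $S=S^{-1}$, the Cayley graph $\mathrm{Cay}(G,S)$ has vertex set $G$, with $g$ and $h$ adjacent iff $hg^{-1}\in S$. A perfect code in a graph is a set $C$ of vertices, no two adjacent, such that every vertex outside $C$ is adjacent to exactly one vertex of $C$. A subgroup $H$ of $G$ is a perfect code of $G$ if some Cayley graph $\mathrm{Cay}(G,S)$ of $G$ has $H$ as a perfect code.
   Formalization: The formal theorem adds the assumption that x_1 does not lie in the subgroup generated by x_2,…,x_m (x_1 is not a redundant generator); without it the claim fails, e.g. n=2, H trivial, x_1=1, x=(1 2). *)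

(* Defs.v *)
From mathcomp Require Import all_boot all_fingroup.

Set Implicit Arguments.
Unset Strict Implicit.
Unset Printing Implicit Defensive.

Local Open Scope group_scope.

(* S^-1 is the pointwise inverse {s^-1 | s in S}. *)
Definition connection_set (gT : finGroupType) (S : {set gT}) : Prop :=
  1 \notin S /\ S^-1 = S.

(* On permutations, g * h is "g, then h"; inversion is an isomorphism of S_n
   with its opposite, so the convention is immaterial here. *)
Definition cayley (gT : finGroupType) (S : {set gT}) : rel gT :=
  fun g h => h * g^-1 \in S.

Definition perfect_code (T : finType) (e : rel T) (C : {set T}) : Prop :=
  (forall u v, u \in C -> v \in C -> ~~ e u v) /\
  (forall v, v \notin C -> exists! c, c \in C /\ e v c).

(* The ambient group is the whole type gT. *)
Definition subgroup_perfect_code (gT : finGroupType) (H : {group gT}) : Prop :=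
  exists S : {set gT}, connection_set S /\ perfect_code (cayley S) H.

(* Main.v *)
(* The element x centralises H and x^2 lies in H, so the coset H x^-1 is closed
   under inversion. A perfect code picks exactly one connection element in this
   coset, which is therefore an involution c x^-1 with c in H; hence x_1 = x^2 =
   c^2 is a square in H. Modulo the subgroup K generated by the other x_i, H is
   the cyclic 2-group generated by x_1, where a generator is a square only if it
   is trivial: x_1 lies in K, against x1_irr. *)
Require Import Defs.
From mathcomp Require Import all_boot all_fingroup.
From mathcomp Require Import cyclic.

Local Open Scope group_scope.

Lemma perfect_code_square (gT : finGroupType) (H : {group gT}) (x : gT) :
    subgroup_perfect_code H -> x \notin H -> x ^+ 2 \in H -> x \in 'C(H) ->
  exists2 c, c \in H & c ^+ 2 = x ^+ 2.
Proof.
move=> [S [[_ SV] [_ codeH]]] xNH x2H /centP cxH.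
have [c [[cH cS] c_uniq]] := codeH x xNH; exists c => //.
have xcV : commute x c^-1 by apply: cxH; rewrite groupV.
(* The inverse of [c * x^-1] is [c^-1 * x ^+ 2 * x^-1], so [c^-1 * x ^+ 2] is also a neighbour of
   [x] in [H]. *)
have eq_c : c = c^-1 * x ^+ 2.
  apply: c_uniq; split; first by rewrite groupM ?groupV.
  rewrite /cayley expgS expg1 mulgA mulgK -xcV.
  by rewrite -(invgK x) -invMg -mem_invg SV.
by rewrite expgS expg1 {2}eq_c mulKVg.
Qed.

(** Substituting the equation into itself [k] times puts [z] in [z ^+ ((2 * a) ^ k) * K], and
    [2 ^ k] divides this exponent. *)
Lemma mem_group_of_square (gT : finGroupType) (K : {group gT}) (z y : gT)
    (a k : nat) :
    z ^+ (2 ^ k)%N = 1 -> y \in K -> commute z y -> z = z ^+ (2 * a)%N * y ->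
  z \in K.
Proof.
move=> zk yK czy def_z.
have [w wK ->] : exists2 w, w \in K & z = z ^+ ((2 * a) ^ k)%N * w.
  elim: k {zk} => [|k [w wK def_w]]; first by exists 1; rewrite ?mulg1.
  exists (y ^+ ((2 * a) ^ k)%N * w); first by rewrite groupM ?groupX.
  rewrite expnS expgM mulgA -expgMn -?def_z //.
  exact/commute_sym/commuteX/commute_sym.
by rewrite expnMn expgM zk expg1n mul1g.
Qed.

(* The informal m >= 1 is m.+1 here: the generators are x_ 0, ..., x_ m, and
   x_1 is x_ ord0. Hypothesis x1_irr is the part of the convention that the
   list of generators is minimal which concerns x_1; without it the claim is
   false (n = 2, H = 1, x_1 = 1, x the transposition). *)
Theorem theorem5 (n m k : nat) (x_ : 'I_m.+1 -> 'S_n) (H : {group 'S_n})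
    (defH : H = <<[set x_ i | i : 'I_m.+1]>> :> {set 'S_n})
    (abelH : abelian H)
    (cardH : #|H| = (2 ^ k)%N)
    (x1_irr : x_ ord0 \notin <<[set x_ i | i in [set~ ord0]]>>)
    (x : 'S_n) (xNH : x \notin H) (x2 : x ^+ 2 = x_ ord0)
    (cx : forall i : 'I_m.+1, i != ord0 -> x * x_ i = x_ i * x) :
  ~ subgroup_perfect_code H.
Proof.
move=> codeH; set x1 := x_ ord0 in x1_irr x2.
set K := <<_>> in x1_irr.
have xH i : x_ i \in H by rewrite defH mem_gen ?imset_f.
have x1H : x1 \in H := xH ord0.
have KH : K \subset H.
  by rewrite gen_subG; apply/subsetP=> _ /imsetP[i _ ->].
have x_cent : x \in 'C(H).
  rewrite defH cent_gen; apply/centP=> _ /imsetP[i _ ->].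
  have [-> | /cx //] := eqVneq i ord0.
  by rewrite -/x1 -x2; apply: commuteX.
have [|c cH c2] := perfect_code_square _ _ _ codeH xNH _ x_cent.
  by rewrite x2.
have x1K : K \subset 'C(<[x1]>).
  by rewrite (subset_trans KH) // (subset_trans abelH) // centS // cycle_subG.
have H_mul : H \subset <[x1]> * K.
  rewrite -(cent_joinEr x1K) defH gen_subG; apply/subsetP=> _ /imsetP[i _ ->].
  have [-> | ni0] := eqVneq i ord0; first by rewrite mem_gen // inE cycle_id.
  by rewrite mem_gen // inE orbC mem_gen // imset_f // !inE.
have /mulsgP[_ y /cycleP[a ->] yK def_c] := subsetP H_mul c cH.
have cx1y : commute x1 y by apply: (centsP abelH) => //; apply: (subsetP KH).
(* Squaring [c = x1 ^+ a * y] gives [x1 = x1 ^+ (2 * a) * y ^+ 2]. *)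
case/negP: x1_irr; apply: (mem_group_of_square _ _ _ (y ^+ 2) a k).
- by rewrite -cardH expg_cardG.
- exact: groupX.
- exact: commuteX.
rewrite mulnC expgM -expgMn -?def_c ?c2 //.
exact/commute_sym/commuteX/commute_sym.
Qed.
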